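(* Let $A,B$ be complex Banach algebras and let $\Phi:A\to B$ be a linear map admitting a pg-inverse $\Psi$. Then the following statements hold: (a) $\Phi$ maps regular elements in $A$ to regular elements in $B$, that is, $\Phi$ is a weak regular preserver; more concretely, if $b$ is a generalized inverse of $a$, then $\Psi(b)$ is a generalized inverse of $\Phi(a)$; (b) if $A$ is unital and $(\Phi,\Psi)$ is Jordan-triple multiplicative, then $\ker(\Phi)=\ker(\Psi)$; (c) if $A$ is unital and $(\Phi,\Psi)$ is Jordan-triple multiplicative, then $\Phi$ is norm continuous if and only if $\Psi$ is norm continuous; (d) if $A$ and $B$ are unital and $\Phi(1)$ is invertible in $B$, then $\Psi=R_{\Phi(1)^{-1}}\circ L_{\Phi(1)^{-1}}\circ\Phi$ is the unique pg-inverse of $\Phi$; (e) if $\Phi_1:C\to A$ and $\Phi_2:B\to C$ are linear maps admitting a pg-inverse, where $C$ is a (complex) Banach algebra, then $\Phi_2\Phi$ and $\Phi\Phi_1$ admit a pg-inverse too. In particular, if $A$ and $B$ are C$^*$-algebras, then the maps $x\mapsto\Phi(x)^*$, $x\mapsto\Phi(x^* )$ and $x\mapsto\Phi(x^* )^*$ admit pg-inverses.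
   Context: For linear maps $\Phi,\Psi:A\to B$ between complex Banach algebras, $\Psi$ is a pointwise-generalized-inverse (pg-inverse) of $\Phi$ if $\Phi(aba)=\Phi(a)\Psi(b)\Phi(a)$ for all $a,b\in A$. The pair $(\Phi,\Psi)$ is Jordan-triple multiplicative if $\Psi$ is a pg-inverse of $\Phi$ and $\Phi$ is a pg-inverse of $\Psi$, i.e. moreover $\Psi(aba)=\Psi(a)\Phi(b)\Psi(a)$ for all $a,b\in A$. An element $a$ of an associative ring is regular if there is an element $b$ of the ring (a generalized inverse of $a$) with $aba=a$. $L_b$ and $R_b$ denote left and right multiplication by $b$: $L_b(x)=bx$, $R_b(x)=xb$. *)

(* Defs.v *)
From HB Require Import structures.
From mathcomp Require Import all_boot all_order all_algebra.
From mathcomp Require Import complex.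
From mathcomp Require Import all_classical all_reals topology normedtype.

Set Implicit Arguments.
Unset Strict Implicit.
Unset Printing Implicit Defensive.

Import Order.TTheory GRing.Theory Num.Theory.
Import numFieldNormedType.Exports.

Local Open Scope classical_set_scope.
Local Open Scope ring_scope.

Declare Scope banach_scope.
Delimit Scope banach_scope with B.

(* Banach algebras need not be unital here, so the multiplication cannot come
   from the ring structures of MathComp, which all include a unit. *)
HB.mixin Record CompleteNormedModule_isBanachAlgebra (K : numFieldType) A
    of CompleteNormedModule K A := {
  bmul : A -> A -> A;
  bmulA : associative bmul;
  bmulDl : left_distributive bmul +%R;
  bmulDr : right_distributive bmul +%R;
  bscaleAl : forall (k : K) (x y : A), k *: bmul x y = bmul (k *: x) y;
  bscaleAr : forall (k : K) (x y : A), k *: bmul x y = bmul x (k *: y);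
  ler_normBM : forall x y : A, `|bmul x y| <= `|x| * `|y|
}.

#[short(type="banachAlgType")]
HB.structure Definition BanachAlgebra (K : numFieldType) :=
  {A of CompleteNormedModule K A & CompleteNormedModule_isBanachAlgebra K A}.

Infix "**" := bmul (at level 40, left associativity) : banach_scope.
Local Open Scope banach_scope.

Section BanachAlgebraTheory.
Context {K : numFieldType}.
Implicit Types A B : banachAlgType K.

Definition is_unit A (e : A) : Prop := forall x : A, e ** x = x /\ x ** e = x.

(* The norm of the unit is not required to be 1, and A may be zero. *)
Definition unital A : Prop := exists e : A, is_unit e.

Definition is_inverse A (e x y : A) : Prop := x ** y = e /\ y ** x = e.

Definition Lmul A (b : A) : A -> A := fun x => b ** x.
Definition Rmul A (b : A) : A -> A := fun x => x ** b.

Definition generalized_inverse A (a b : A) : Prop := a ** b ** a = a.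

Definition regular A (a : A) : Prop := exists b : A, generalized_inverse a b.

Definition weak_regular_preserver A B (Phi : A -> B) : Prop :=
  forall a : A, regular a -> regular (Phi a).

(* [pg_inverse Phi Psi]: Psi is a pg-inverse of Phi.  Only the identity is
   recorded; (semi)linearity is carried by the types of the maps. *)
Definition pg_inverse A B (Phi Psi : A -> B) : Prop :=
  forall a b : A, Phi (a ** b ** a) = Phi a ** Psi b ** Phi a.

Definition Jordan_triple_multiplicative A B (Phi Psi : A -> B) : Prop :=
  pg_inverse Phi Psi /\ pg_inverse Psi Phi.

Definition admits_pg_inverse A B (Phi : A -> B) : Prop :=
  exists Psi : {linear A -> B}, pg_inverse Phi Psi.

End BanachAlgebraTheory.

Notation "{ 'conj_linear' A -> B }" :=
  {linear A -> B | Num.conj \; *:%R} (at level 0, A at level 98, B at level 99)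
  : type_scope.

Section ComplexBanachAlgebras.
Context {R : realType}.
Implicit Types A B : banachAlgType R[i].

(* The version of [admits_pg_inverse] for conjugate-linear maps such as
   x |-> (Phi x)^* : the pg-inverse must then be conjugate-linear. *)
Definition admits_conj_pg_inverse A B (Phi : A -> B) : Prop :=
  exists Psi : {conj_linear A -> B}, pg_inverse Phi Psi.

(* [is_cstar star]: the Banach algebra A is a C*-algebra with involution
   [star]. *)
Record is_cstar A (star : A -> A) : Prop := {
  cstarD : {morph star : x y / x + y};
  cstarZ : forall (k : R[i]) (x : A), star (k *: x) = Num.conj k *: star x;
  cstarM : forall x y : A, star (x ** y) = star y ** star x;
  cstarK : involutive star;
  cstar_norm : forall x : A, `|star x ** x| = `|x| ^+ 2
}.

End ComplexBanachAlgebras.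

(* Main.v *)
(* Taking a = 1 in the defining identity gives
   Phi b = Phi 1 ** Psi b ** Phi 1, so Phi is Psi followed by a continuous
   linear map; this controls kernels and continuity, and when Phi 1 is invertible
   it can be solved for Psi.  An involution reverses products, hence fixes the
   shape of a triple product a ** b ** a and is a pg-inverse of itself. *)
Require Import Defs.
From HB Require Import structures.
From mathcomp Require Import all_boot all_order all_algebra.
From mathcomp Require Import complex.
From mathcomp Require Import all_classical all_reals topology normedtype.

Set Implicit Arguments.
Unset Strict Implicit.
Unset Printing Implicit Defensive.

Import Order.TTheory GRing.Theory Num.Theory.
Import numFieldNormedType.Exports.

Local Open Scope classical_set_scope.
Local Open Scope ring_scope.
Local Open Scope banach_scope.

Section PgInverse.
Context {K : numFieldType}.
Implicit Types A B C : banachAlgType K.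

Lemma bmul0r A (x : A) : 0 ** x = 0.
Proof. by rewrite -[X in X ** _](scale0r x) -bscaleAl scale0r. Qed.

Lemma bmulr0 A (x : A) : x ** 0 = 0.
Proof. by rewrite -[X in _ ** X](scale0r x) -bscaleAr scale0r. Qed.

Lemma Lmul_linear A (b : A) : linear (Lmul b).
Proof. by move=> k x y; rewrite /Lmul bmulDr bscaleAr. Qed.

Lemma Rmul_linear A (b : A) : linear (Rmul b).
Proof. by move=> k x y; rewrite /Rmul bmulDl bscaleAl. Qed.

(** With these linear structures, continuity of a multiplication operator reduces to boundedness. *)
HB.instance Definition _ A (b : A) :=
  GRing.isLinear.Build K A A *:%R (Lmul b) (Lmul_linear b).
HB.instance Definition _ A (b : A) :=
  GRing.isLinear.Build K A A *:%R (Rmul b) (Rmul_linear b).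

Lemma Lmul_continuous A (b : A) : continuous (Lmul b).
Proof.
apply/bounded_linear_continuous/linear_boundedP; near=> M => x.
apply: le_trans (ler_normBM _ _) _; apply: ler_wpM2r => //.
(* Submultiplicativity of the norm makes any [M] above the norm of [b] a valid bound. *)
near: M; apply: nbhs_pinfty_ge; exact: normr_real.
Unshelve. all: by end_near. Qed.

Lemma Rmul_continuous A (b : A) : continuous (Rmul b).
Proof.
apply/bounded_linear_continuous/linear_boundedP; near=> M => x.
apply: le_trans (ler_normBM _ _) _; rewrite mulrC; apply: ler_wpM2r => //.
near: M; apply: nbhs_pinfty_ge; exact: normr_real.
Unshelve. all: by end_near. Qed.

Lemma generalized_inverse_pg A B (Phi Psi : A -> B) (a b : A) :
  pg_inverse Phi Psi -> generalized_inverse a b ->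
  generalized_inverse (Phi a) (Psi b).
Proof. by move=> PhiPsi ab; rewrite /generalized_inverse -PhiPsi ab. Qed.

Lemma pg_inverse_unit A B (Phi Psi : A -> B) (e x : A) :
  is_unit e -> pg_inverse Phi Psi -> Phi x = Phi e ** Psi x ** Phi e.
Proof.
by move=> e1 PhiPsi; rewrite -PhiPsi (proj1 (e1 x)) (proj2 (e1 x)).
Qed.

(** One inclusion per pg-inverse identity: a Jordan-triple multiplicative pair yields equality by
    exchanging the two maps. *)
Lemma pg_inverse_ker_sub A B (Phi Psi : A -> B) :
  unital A -> pg_inverse Phi Psi ->
  Psi @^-1` [set 0] `<=` Phi @^-1` [set 0].
Proof.
move=> [e e1] PhiPsi x /= Psix0.
by rewrite (pg_inverse_unit x e1 PhiPsi) Psix0 bmulr0 bmul0r.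
Qed.

Lemma pg_inverse_continuous A B (Phi Psi : A -> B) :
  unital A -> pg_inverse Phi Psi -> continuous Psi -> continuous Phi.
Proof.
move=> [e e1] PhiPsi Psi_cont.
have -> : Phi = Rmul (Phi e) \o (Lmul (Phi e) \o Psi).
  by apply/funext => x; exact: pg_inverse_unit.
move=> x; apply: continuous_comp; last exact: Rmul_continuous.
by apply: continuous_comp; [exact: Psi_cont | exact: Lmul_continuous].
Qed.

(** Multiply [Phi x = Phi eA ** Psi x ** Phi eA] by [c] on both sides. The resulting formula
    involves only [Phi] and [c], so it also gives uniqueness. *)
Lemma pg_inverse_unitE A B (Phi Psi : A -> B) (eA : A) (eB c : B) :
  is_unit eA -> is_unit eB -> is_inverse eB (Phi eA) c ->
  pg_inverse Phi Psi -> Psi =1 Rmul c \o Lmul c \o Phi.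
Proof.
move=> eA1 eB1 [Phic cPhi] PhiPsi x /=.
rewrite /Rmul /Lmul (pg_inverse_unit x eA1 PhiPsi) !bmulA cPhi.
by rewrite -bmulA Phic (proj2 (eB1 _)) (proj1 (eB1 _)).
Qed.

(** Stated for bare functions so that involutions, which are only conjugate-linear, can be among the
    factors. *)
Lemma pg_inverse_comp A B C (Phi Psi : A -> B) (Phi' Psi' : B -> C) :
  pg_inverse Phi Psi -> pg_inverse Phi' Psi' ->
  pg_inverse (Phi' \o Phi) (Psi' \o Psi).
Proof. by move=> PhiPsi Phi'Psi' a b /=; rewrite PhiPsi Phi'Psi'. Qed.

Lemma admits_pg_inverse_comp A B C (Phi : A -> B) (Phi' : B -> C) :
  admits_pg_inverse Phi -> admits_pg_inverse Phi' ->
  admits_pg_inverse (Phi' \o Phi).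
Proof.
move=> [Psi PhiPsi] [Psi' Phi'Psi'].
by exists (Psi' \o Psi); exact: pg_inverse_comp.
Qed.

End PgInverse.

Section Star.
Context {R : realType}.
Implicit Types A B : banachAlgType R[i].

Lemma pg_inverse_star A (star : A -> A) :
  is_cstar star -> pg_inverse star star.
Proof. by move=> starA a b; rewrite !(cstarM starA) bmulA. Qed.

Lemma pg_inverse_starl A B (starB : B -> B) (Phi : A -> B)
    (Psi : {linear A -> B}) :
  is_cstar starB -> pg_inverse Phi Psi ->
  admits_conj_pg_inverse (starB \o Phi).
Proof.
move=> cB PhiPsi.
have lin : linear_for (Num.conj \; *:%R) (starB \o Psi).
  by move=> k x y /=; rewrite linearP (cstarD cB) (cstarZ cB).
(* Conjugate-linearity depends on the hypothesis [cB], so the bundled map is assembled inside the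
   proof. *)
pose L := GRing.isLinear.Build _ _ _ _ _ lin.
pose Psi' : {conj_linear A -> B} := HB.pack (starB \o Psi) L.
by exists Psi'; exact: pg_inverse_comp PhiPsi (pg_inverse_star cB).
Qed.

Lemma pg_inverse_starr A B (starA : A -> A) (Phi : A -> B)
    (Psi : {linear A -> B}) :
  is_cstar starA -> pg_inverse Phi Psi ->
  admits_conj_pg_inverse (Phi \o starA).
Proof.
move=> cA PhiPsi.
have lin : linear_for (Num.conj \; *:%R) (Psi \o starA).
  by move=> k x y /=; rewrite (cstarD cA) (cstarZ cA) linearP.
pose L := GRing.isLinear.Build _ _ _ _ _ lin.
pose Psi' : {conj_linear A -> B} := HB.pack (Psi \o starA) L.
by exists Psi'; exact: pg_inverse_comp (pg_inverse_star cA) PhiPsi.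
Qed.

(** The two conjugations of scalars cancel, so here the pg-inverse is genuinely linear. *)
Lemma pg_inverse_starlr A B (starA : A -> A) (starB : B -> B) (Phi : A -> B)
    (Psi : {linear A -> B}) :
  is_cstar starA -> is_cstar starB -> pg_inverse Phi Psi ->
  admits_pg_inverse (starB \o Phi \o starA).
Proof.
move=> cA cB PhiPsi.
have lin : linear (starB \o Psi \o starA).
  move=> k x y /=.
  by rewrite (cstarD cA) (cstarZ cA) linearP (cstarD cB) (cstarZ cB) conjCK.
pose L := GRing.isLinear.Build _ _ _ _ _ lin.
pose Psi' : {linear A -> B} := HB.pack (starB \o Psi \o starA) L.
exists Psi'; apply: pg_inverse_comp (pg_inverse_star cA) _.
exact: pg_inverse_comp PhiPsi (pg_inverse_star cB).
Qed.

End Star.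

Theorem lemma2p1 (R : realType) (A B : banachAlgType R[i])
    (Phi Psi : {linear A -> B}) (Phi_Psi : pg_inverse Phi Psi) :
  (* (a) *)
  (weak_regular_preserver Phi /\
   (forall a b : A, generalized_inverse a b ->
      generalized_inverse (Phi a) (Psi b))) /\
  (* (b) *)
  (unital A -> Jordan_triple_multiplicative Phi Psi ->
     Phi @^-1` [set 0] = Psi @^-1` [set 0]) /\
  (* (c) *)
  (unital A -> Jordan_triple_multiplicative Phi Psi ->
     (continuous Phi <-> continuous Psi)) /\
  (* (d) *)
  (forall (eA : A) (eB : B), is_unit eA -> is_unit eB ->
     forall c : B, is_inverse eB (Phi eA) c ->
       Psi =1 Rmul c \o Lmul c \o Phi /\
       (forall Psi' : {linear A -> B}, pg_inverse Phi Psi' -> Psi' =1 Psi)) /\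
  (* (e) *)
  (forall (C : banachAlgType R[i])
      (Phi1 : {linear C -> A}) (Phi2 : {linear B -> C}),
     admits_pg_inverse Phi1 -> admits_pg_inverse Phi2 ->
       admits_pg_inverse (Phi2 \o Phi) /\ admits_pg_inverse (Phi \o Phi1)) /\
  (forall (starA : A -> A) (starB : B -> B), is_cstar starA -> is_cstar starB ->
     [/\ admits_conj_pg_inverse (fun x => starB (Phi x)),
         admits_conj_pg_inverse (fun x => Phi (starA x)) &
         admits_pg_inverse (fun x => starB (Phi (starA x)))]).
Proof.
split; [split | split; [|split; [|split; [|split]]]].
- by move=> a [b ab]; exists (Psi b); exact: generalized_inverse_pg ab.
- by move=> a b; exact: generalized_inverse_pg.
- move=> A1 [_ Psi_Phi].
  (* The first inclusion comes from [Psi_Phi], the second from [Phi_Psi]. *)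
  by apply/seteqP; split; exact: pg_inverse_ker_sub.
- by move=> A1 [_ Psi_Phi]; split; exact: pg_inverse_continuous.
- move=> eA eB eA1 eB1 c cP.
  have PsiE := pg_inverse_unitE eA1 eB1 cP.
  (* [PsiE] holds for every pg-inverse of [Phi], hence rewrites [Psi'] and [Psi] to the same
     expression. *)
  by split=> [|Psi' Psi'P x]; [exact: PsiE | rewrite !PsiE].
- move=> C Phi1 Phi2 Phi1P Phi2P.
  have PhiP : admits_pg_inverse Phi by exists Psi.
  by split; exact: admits_pg_inverse_comp.
- move=> starA starB cA cB; split.
  + exact: pg_inverse_starl Phi_Psi.
  + exact: pg_inverse_starr Phi_Psi.
  + exact: pg_inverse_starlr Phi_Psi.
Qed.
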